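(* In the diagonal model, the length generating function of bridges formed of partially directed irreducible bridges is $$ W_\Delta(t)=\frac{1}{1+2t-\dfrac{2tB_1}{1+tB_1}-\dfrac{4tB_2}{1+2tB_2}+\dfrac{2tB_0}{1+tB_0}}, $$ where $B_i=\sum_{k\ge0}B_i^{(k)}(t)$ for $i=0,1,2$, and $B_0^{(k)}$, $B_1^{(k)}$, $B_2^{(k)}$ are the length generating functions of ES-, ESW- and NES-pseudo-bridges of height $k$, respectively.
   Context: The square lattice steps are N$=(0,1)$, E$=(1,0)$, S$=(0,-1)$, W$=(-1,0)$. All walks $v_0,\dots,v_n$ on $\mathbb{Z}^2$ are self-avoiding and counted up to translation by their length; the empty walk is allowed. For a set $\mathcal S$ of steps, an $\mathcal S$-walk is a self-avoiding walk with all steps in $\mathcal S$. A walk is partially directed if it avoids at least one of the four steps. Diagonal model: the height $h(v)$ of a vertex is the sum of its two coordinates. A walk is a bridge if all vertices $v\ne v_n$ satisfy $h(v_0)\le h(v)<h(v_n)$, a pseudo-bridge if all vertices satisfy $h(v_0)\le h(v)\le h(v_n)$ (its height is $h(v_n)-h(v_0)$). An irreducible bridge is a nonempty bridge that is not a concatenation of two nonempty bridges; every bridge factors uniquely into irreducible bridges. ''Bridges formed of partially directed irreducible bridges'' are the bridges (including the empty one) all of whose irreducible bridges are partially directed. Explicitly: $B_1^{(k)}=t^k/G_k(t)$ and $B_2^{(k)}=(2-t^2)^kt^k/G_k(t)$, where $G_0=1$, $G_1=1-t^2$, $G_{k+1}=(1+t^2)G_k-t^2(2-t^2)G_{k-1}$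 for $k\ge1$; and $B_0^{(k)}=t^k/F_k(t)$, where $F_{-1}=F_0=1$, $F_{k+1}=F_k-t^2F_{k-1}$ for $k\ge0$. *)

(* Defs.v *)
From HB Require Import structures.
From mathcomp Require Import all_boot all_order all_algebra.
From mathcomp Require Import boolp.

Set Implicit Arguments.
Unset Strict Implicit.
Unset Printing Implicit Defensive.

Import Order.TTheory GRing.Theory Num.Theory.
Local Open Scope ring_scope.

Record fps (R : Type) := FPS { coefs : nat -> R }.

HB.instance Definition _ (R : Type) := gen_eqMixin (fps R).
HB.instance Definition _ (R : Type) := gen_choiceMixin (fps R).

Lemma fpsP (R : Type) (a b : fps R) : coefs a =1 coefs b <-> a = b.
Proof.
split=> [|->//]; case: a => a; case: b => b /= eq_ab.
by congr FPS; apply: funext.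
Qed.

Section FpsRing.
Variable R : comUnitRingType.
Implicit Types a b c : fps R.

Definition fps_zero : fps R := FPS (fun=> 0).
Definition fps_one : fps R := FPS (fun n => (n == 0%N)%:R).
Definition fps_opp a : fps R := FPS (fun n => - coefs a n).
Definition fps_add a b : fps R := FPS (fun n => coefs a n + coefs b n).
Definition fps_mul a b : fps R :=
  FPS (fun n => \sum_(i < n.+1) coefs a i * coefs b (n - i)).

Definition fpsX : fps R := FPS (fun n => (n == 1%N)%:R).

Fact fps_addA : associative fps_add.
Proof. by move=> a b c; apply/fpsP => n /=; rewrite addrA. Qed.
Fact fps_addC : commutative fps_add.
Proof. by move=> a b; apply/fpsP => n /=; rewrite addrC. Qed.
Fact fps_add0 : left_id fps_zero fps_add.
Proof. by move=> a; apply/fpsP => n /=; rewrite add0r. Qed.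
Fact fps_addN : left_inverse fps_zero fps_opp fps_add.
Proof. by move=> a; apply/fpsP => n /=; rewrite addNr. Qed.

HB.instance Definition _ :=
  GRing.isZmodule.Build (fps R) fps_addA fps_addC fps_add0 fps_addN.

Definition fps_trunc m a : {poly R} := \poly_(i < m) coefs a i.

Lemma coefs_mul_trunc m n a b : (n < m)%N ->
  coefs (fps_mul a b) n = (fps_trunc m a * fps_trunc m b)`_n.
Proof.
move=> lt_nm; rewrite coefM; apply: eq_bigr => i _.
by rewrite !coef_poly !(leq_ltn_trans _ lt_nm) ?leq_subr // -ltnS.
Qed.

Fact fps_mulA : associative fps_mul.
Proof.
move=> a b c; apply/fpsP => n.
transitivity ((fps_trunc n.+1 a * fps_trunc n.+1 b * fps_trunc n.+1 c)`_n).
  rewrite -mulrA coefM; apply: eq_bigr => i _.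
  have lt_i : (n - i < n.+1)%N by rewrite ltnS leq_subr.
  by rewrite -(coefs_mul_trunc _ _ lt_i) coef_poly ltn_ord.
rewrite coefM; apply: eq_bigr => i _.
have lt_i : (n - i < n.+1)%N by rewrite ltnS leq_subr.
by rewrite -coefs_mul_trunc ?ltn_ord // coef_poly lt_i.
Qed.

Fact fps_mulC : commutative fps_mul.
Proof.
move=> a b; apply/fpsP => n.
by rewrite !(coefs_mul_trunc _ _ (ltnSn n)) mulrC.
Qed.

Fact fps_mul1 : left_id fps_one fps_mul.
Proof.
move=> a; apply/fpsP => n /=; rewrite big_ord_recl /= mul1r subn0.
by rewrite big1 ?addr0 // => i _; rewrite mul0r.
Qed.

Fact fps_mulDl : left_distributive fps_mul fps_add.
Proof.
move=> a b c; apply/fpsP => n /=; rewrite -big_split.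
by apply: eq_bigr => i _; rewrite mulrDl.
Qed.

Fact fps_1neq0 : fps_one != fps_zero.
Proof.
apply/eqP => /fpsP /(_ 0%N) /= /eqP.
by rewrite oner_eq0.
Qed.

HB.instance Definition _ := GRing.Zmodule_isComNzRing.Build (fps R)
  fps_mulA fps_mulC fps_mul1 fps_mulDl fps_1neq0.

Definition fps_unit : {pred fps R} := fun a => coefs a 0%N \is a GRing.unit.

(* [fps_inv_seq a n] lists the first [n.+1] coefficients of the inverse of [a],
   solving [\sum_(i <= n) a_i b_(n-i) = 0] for [b_n]. *)
Fixpoint fps_inv_seq a (n : nat) : seq R :=
  if n is m.+1 then
    let s := fps_inv_seq a m in
    rcons s (- (coefs a 0%N)^-1 * \sum_(i < m.+1) coefs a i.+1 * s`_(m - i))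
  else [:: (coefs a 0%N)^-1].

(* As for every [unitRingType], the inverse of a non-unit is itself. *)
Definition fps_inv a : fps R :=
  if a \in fps_unit then FPS (fun n => (fps_inv_seq a n)`_n) else a.

Lemma size_fps_inv_seq a n : size (fps_inv_seq a n) = n.+1.
Proof. by elim: n => //= n IHn; rewrite size_rcons IHn. Qed.

Lemma nth_fps_inv_seq a m n : (m <= n)%N ->
  (fps_inv_seq a n)`_m = (fps_inv_seq a m)`_m.
Proof.
elim: n => [|n IHn]; first by rewrite leqn0 => /eqP->.
rewrite leq_eqVlt => /predU1P[-> // | lt_mn].
by rewrite /= nth_rcons size_fps_inv_seq lt_mn IHn.
Qed.

Fact fps_mulVx : {in fps_unit, left_inverse 1 fps_inv *%R}.
Proof.
move=> a Ua; rewrite mulrC /fps_inv Ua; apply/fpsP => -[|n] /=.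
  by rewrite big_ord_recl big_ord0 addr0 /= divrr.
rewrite big_ord_recl subn0 /= nth_rcons size_fps_inv_seq ltnn eqxx.
rewrite mulNr mulrN mulVKr //; apply/eqP; rewrite addrC subr_eq0; apply/eqP.
apply: eq_bigr => i _; rewrite /bump /= add1n subSS.
by rewrite [in RHS]nth_fps_inv_seq ?leq_subr.
Qed.

Fact fps_unitP : forall a b, b * a = 1 -> fps_unit a.
Proof.
move=> a b /fpsP /(_ 0%N) /=.
rewrite big_ord_recl big_ord0 addr0 /= => ba1.
by apply/unitrPr; exists (coefs b 0%N); rewrite mulrC.
Qed.

Fact fps_inv_out : {in [predC fps_unit], fps_inv =1 id}.
Proof. by move=> a; rewrite inE /= /fps_inv => /negPf->. Qed.

HB.instance Definition _ := GRing.ComNzRing_hasMulInverse.Build (fps R)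
  fps_mulVx fps_unitP fps_inv_out.

(* The sum of a family [f] in which [f k] is divisible by [t ^+ k]; only the
   first [n.+1] terms then contribute to the coefficient of [t ^+ n], see
   [coefs_fps_sum]. *)
Definition fps_sum (f : nat -> fps R) : fps R :=
  FPS (fun n => \sum_(k < n.+1) coefs (f k) n).

Lemma coefs_fps_sum (f : nat -> fps R) (m n : nat) :
  (forall k i : nat, (i < k)%N -> coefs (f k) i = 0) -> (n < m)%N ->
  coefs (fps_sum f) n = \sum_(k < m) coefs (f k) n.
Proof.
move=> f0 lt_nm; rewrite /= -!(big_mkord xpredT (fun k => coefs (f k) n)).
rewrite (big_cat_nat (leq0n _) lt_nm) /= [X in _ = _ + X]big_nat_cond.
rewrite [X in _ = _ + X]big1 ?addr0 // => k /andP[/andP[lt_nk _] _].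
exact: f0.
Qed.

End FpsRing.

Arguments fpsX {R}.

Inductive step := North | East | South | West.

Definition vect (s : step) : int * int :=
  match s with
  | North => (0, 1)
  | East => (1, 0)
  | South => (0, -1)
  | West => (-1, 0)
  end.

Definition ord_of_step (s : step) : 'I_4 :=
  match s with
  | North => inord 0 | East => inord 1 | South => inord 2 | West => inord 3
  end.
Definition step_of_ord (i : 'I_4) : step :=
  match val i with 0 => North | 1 => East | 2 => South | _ => West end%N.

Fact ord_of_stepK : cancel ord_of_step step_of_ord.
Proof. by case; rewrite /step_of_ord /= inordK. Qed.

HB.instance Definition _ := Finite.copy step (can_type ord_of_stepK).

(* A walk up to translation is the sequence of its steps; as representative we
   take the walk starting at [0]. Self-avoidance is a separate predicate,
   required by each class of walks below. *)
Notation walk := (seq step).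

Definition vertices (w : walk) : seq (int * int) :=
  0 :: scanl +%R 0 (map vect w).

Definition endpoint (w : walk) : int * int := last 0 (vertices w).

Definition self_avoiding (w : walk) : bool := uniq (vertices w).

Definition step_walk (S : {set step}) (w : walk) : bool :=
  self_avoiding w && all (mem S) w.

Definition partially_directed (w : walk) : bool :=
  self_avoiding w && [exists s, s \notin w].

Definition height (v : int * int) : int := v.1 + v.2.

Definition bridge (w : walk) : Prop :=
  self_avoiding w /\
  {in vertices w, forall v, v != endpoint w ->
    height 0 <= height v < height (endpoint w)}.

Definition pseudo_bridge (w : walk) : Prop :=
  self_avoiding w /\
  {in vertices w, forall v,
    height 0 <= height v <= height (endpoint w)}.

Definition step_pseudo_bridge (S : {set step}) (k : nat) (w : walk) : Prop :=
  [/\ step_walk S w, pseudo_bridge w & height (endpoint w) - height 0 = k%:Z].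

Definition irreducible_bridge (w : walk) : Prop :=
  [/\ bridge w, w <> [::] &
      ~ exists u v : walk,
          [/\ w = u ++ v, bridge u, bridge v, u <> [::] & v <> [::]]].

(* The factorization of a bridge into irreducible bridges is unique, so that
   [ws] below is the factorization of [w]. *)
Definition pd_irreducible_bridge (w : walk) : Prop :=
  bridge w /\
  exists ws : seq walk,
    w = flatten ws /\
    {in ws, forall u, irreducible_bridge u /\ partially_directed u}.

Definition length_gf (P : walk -> Prop) : fps int :=
  FPS (fun n => #|[set w : n.-tuple step | `[< P w >]]|%:Z).

Lemma height_endpoint_le (w : walk) : height (endpoint w) <= (size w)%:Z.
Proof.
rewrite /endpoint /vertices /=.
suff H p : height (last p (scanl +%R p (map vect w)))
           <= height p + (size w)%:Z by rewrite (le_trans (H 0)).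
elim: w p => [|s w IHw] p /=; first by rewrite addr0.
rewrite (le_trans (IHw _)) // -[(size w).+1]add1n PoszD addrA lerD2r.
by rewrite /height /= addrACA lerD2l; case: s.
Qed.

(* The hypothesis of [coefs_fps_sum] for pseudo-bridges counted by height. *)
Lemma coefs_step_pseudo_bridge (S : {set step}) (k n : nat) : (n < k)%N ->
  coefs (length_gf (step_pseudo_bridge S k)) n = 0.
Proof.
move=> lt_nk /=; rewrite (_ : [set _ | _] = set0) ?cards0 //.
apply/setP => w; rewrite !inE; apply/negP => /asboolP[_ _].
rewrite (_ : height 0 = 0) // subr0 => hk; have := height_endpoint_le w.
by rewrite hk size_tuple lez_nat leqNgt lt_nk.
Qed.

(* Main.v *)
Require Import Defs.
From mathcomp Require Import all_boot all_order all_algebra.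
From mathcomp Require Import boolp zify ring.
Local Open Scope ring_scope.

Set Implicit Arguments.
Unset Strict Implicit.
Unset Printing Implicit Defensive.

Import Order.TTheory GRing.Theory Num.Theory.

(** The proof rests on three facts.

    Irreducible bridges form a prefix code ([irreducible_bridge_prefix]): if an
    irreducible bridge [u x] extended a nonempty bridge [u] while [x] started
    another bridge, then [x] would itself be a bridge and [u x] would factor.
    Hence, for any class of irreducible bridges with length series [I], the
    concatenations of its members have series [1 / (1 - I)]
    ([length_gf_star]).  With the class of all partially directed irreducible
    bridges this reduces the theorem to computing [I]; with the irreducible
    bridges on a step set [A] it expresses their series [I_A] through that of
    all [A]-bridges, since every bridge is a product of irreducible ones.

    Every step changes the height by one, so a nonempty bridge is exactly a
    pseudo-bridge followed by one of the up steps N and E ([bridge_rcons]).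
    The series of [A]-bridges is thus [1 + c t B], where [c] is the number of
    up steps in [A] and [B] the series of [A]-pseudo-bridges, whence
    [I_A = c t B / (1 + c t B)] ([irreducible_gf_quotient]).

    Finally, a partially directed irreducible bridge avoids N, E, S or W, and
    inclusion-exclusion applies.  A nonempty bridge cannot avoid both N and E,
    and one confined to a line has only up steps ([bridge_line]); so the sum
    collapses to the four single avoidances minus the avoided pairs NW, ES and
    SW ([partially_directed_gf]).  The reflection in the diagonal preserves
    heights and pairs up the classes, and the irreducible bridges avoiding both
    S and W are the two single up steps.  In total
    [I = 2 I_ESW + 2 I_NES - 2 I_ES - 2 t], the subscripts being step sets. *)

(** * Length generating functions *)

Lemma coefs_length_gf (P : walk -> Prop) (n : nat) :
  coefs (length_gf P) n = \sum_(w : n.-tuple step) `[< P w >]%:R.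
Proof.
rewrite /= -sum1_card (big_morph Posz PoszD (erefl _)) big_mkcond /=.
by apply: eq_bigr => w _; rewrite inE; case: asbool.
Qed.

Lemma eq_length_gf (P Q : walk -> Prop) :
  (forall w, P w <-> Q w) -> length_gf P = length_gf Q.
Proof.
by move=> PQ; congr length_gf; apply: funext => w; apply: propext.
Qed.

Lemma coefsD (a b : fps int) (n : nat) :
  coefs (a + b) n = coefs a n + coefs b n.
Proof. by []. Qed.

Lemma coefsB (a b : fps int) (n : nat) :
  coefs (a - b) n = coefs a n - coefs b n.
Proof. by []. Qed.

Lemma length_gf_or (P Q : walk -> Prop) :
  (forall w, P w -> ~ Q w) ->
  length_gf (fun w => P w \/ Q w) = length_gf P + length_gf Q.
Proof.
move=> PQ; apply/fpsP => n.
rewrite coefsD !coefs_length_gf -big_split /=.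
apply: eq_bigr => w _; rewrite asbool_or.
case: (asboolP (P w)) (asboolP (Q w)) => [Pw|_] [Qw|_] //=.
by case: (PQ _ Pw Qw).
Qed.

(** Words of length [i + m] are pairs of words of lengths [i] and [m]. *)
Lemma sum_tuple_cat (T : finType) (i m : nat) (F : seq T -> seq T -> int) :
  \sum_(w : (i + m).-tuple T) F (take i w) (drop i w)
    = \sum_(u : i.-tuple T) \sum_(v : m.-tuple T) F u v.
Proof.
rewrite pair_big /=.
pose h (p : i.-tuple T * m.-tuple T) := cat_tuple p.1 p.2.
rewrite (reindex h) /=.
  apply: eq_bigr => -[u v] _.
  by rewrite take_size_cat ?drop_size_cat ?size_tuple.
apply: onW_bij; apply: inj_card_bij => [[u v] [u' v'] /(congr1 val) /= /eqP|].
  rewrite eqseq_cat ?size_tuple // => /andP[/eqP uu' /eqP vv'].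
  by congr pair; apply: val_inj.
by rewrite card_prod !card_tuple expnD.
Qed.

(** Product formula for languages with unambiguous concatenation. *)
Lemma length_gf_cat (P Q R : walk -> Prop) :
  (forall w, R w <-> exists u v, [/\ w = u ++ v, P u & Q v]) ->
  (forall u v u' v', P u -> Q v -> P u' -> Q v' -> u ++ v = u' ++ v' ->
    size u = size u') ->
  length_gf R = length_gf P * length_gf Q.
Proof.
move=> RPQ uniqPQ; apply/fpsP => n; rewrite coefs_length_gf.
pose F (u v : walk) : int := `[< P u >]%:R * `[< Q v >]%:R.
transitivity (\sum_(i < n.+1) \sum_(w : n.-tuple step)
                F (take i w) (drop i w)).
  rewrite exchange_big /=; apply: eq_bigr => w _.
  case: asboolP => [/RPQ[u [v [def_w Pu Qv]]] | nRw]; last first.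
    rewrite big1 // => i _; rewrite /F.
    case: asboolP => [Pu|_]; last by rewrite mul0r.
    case: asboolP => [Qv|_]; last by rewrite mulr0.
    case: nRw; apply/RPQ; exists (take i w), (drop i w).
    by rewrite cat_take_drop.
  (* By unambiguity, only the cut at [size u] contributes for [w]. *)
  have lt_u : (size u < n.+1)%N.
    by rewrite ltnS -(size_tuple w) def_w size_cat leq_addr.
  rewrite (bigD1 (Ordinal lt_u)) //= def_w take_size_cat // drop_size_cat //.
  rewrite {1}/F !asboolT // big1 ?addr0 // => i.
  rewrite -val_eqE /= /F => /eqP ne_iu.
  case: asboolP => [Pu'|_]; last by rewrite mul0r.
  case: asboolP => [Qv'|_]; last by rewrite mulr0.
  case: ne_iu; rewrite (uniqPQ _ _ _ _ Pu Qv Pu' Qv') ?cat_take_drop //.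
  by rewrite -def_w size_takel // size_tuple -ltnS.
apply: eq_bigr => i _; rewrite !coefs_length_gf.
rewrite big_distrlr /= -(sum_tuple_cat _ _ F) subnKC //.
by rewrite -ltnS.
Qed.

Lemma length_gf_nil : length_gf (fun w => w = [::]) = 1.
Proof.
apply/fpsP => -[|n].
  rewrite coefs_length_gf (bigD1 [tuple]) //= big1 ?addr0 ?asboolT // => w.
  by case/eqP; apply: tuple0.
rewrite coefs_length_gf big1 // => w _; rewrite asboolF // => w0.
by have := size_tuple w; rewrite w0.
Qed.

Lemma length_gf_letter (A : {set step}) :
  length_gf (fun w => exists2 s, s \in A & w = [:: s]) = #|A|%:R * fpsX.
Proof.
rewrite mulr_natl; apply/fpsP => n.
have -> : coefs (fpsX *+ #|A| : fps int) n = (n == 1%N)%:R *+ #|A|.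
  by elim: #|A| => // k IHk; rewrite !mulrS -IHk.
have [->|ne_n1] := eqVneq n 1%N; last first.
  rewrite mul0rn coefs_length_gf big1 // => w _; rewrite asboolF //.
  by case=> s _ ws; case/eqP: ne_n1; rewrite -(size_tuple w) ws.
rewrite /= -[RHS]/(#|A|%:R) natz; congr Posz.
rewrite -(card_imset A (f := fun s => [tuple s])) => [|s s' [] //].
apply: eq_card => w; rewrite inE; apply/asboolP/imsetP => -[s As ws];
  exists s => //; last by rewrite ws.
exact: val_inj.
Qed.

Lemma length_gf_map (f : step -> step) (P : walk -> Prop) :
  involutive f -> length_gf (fun w => P (map f w)) = length_gf P.
Proof.
move=> fK; apply/fpsP => n; rewrite !coefs_length_gf.
rewrite [RHS](reindex (fun w : n.-tuple step => map_tuple f w)) //.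
apply: onW_bij; exists (fun w => map_tuple f w) => w;
  by apply: val_inj => /=; rewrite mapK.
Qed.

(** * Walks as words *)

Lemma endpoint_sum (w : walk) : endpoint w = \sum_(s <- w) vect s.
Proof.
suff H p : last p (scanl +%R p (map vect w)) = p + \sum_(s <- w) vect s.
  by rewrite /endpoint /= H add0r.
elim: w p => [|s w IHw] p /=; first by rewrite big_nil addr0.
by rewrite big_cons addrA IHw.
Qed.

Lemma endpoint_cat (u v : walk) : endpoint (u ++ v) = endpoint u + endpoint v.
Proof. by rewrite !endpoint_sum big_cat. Qed.

Lemma endpoint_cons (s : step) (w : walk) :
  endpoint (s :: w) = vect s + endpoint w.
Proof. by rewrite !endpoint_sum big_cons. Qed.

(** The height gained along a walk. *)
Definition rise (w : walk) : int := height (endpoint w).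

Lemma rise_nil : rise [::] = 0. Proof. by []. Qed.

Lemma rise_cat (u v : walk) : rise (u ++ v) = rise u + rise v.
Proof. by rewrite /rise endpoint_cat /height /= addrACA. Qed.

Lemma rise_cons (s : step) (w : walk) :
  rise (s :: w) = height (vect s) + rise w.
Proof. by rewrite /rise endpoint_cons /height /= addrACA. Qed.

Lemma rise_rcons (w : walk) (s : step) :
  rise (rcons w s) = rise w + height (vect s).
Proof. by rewrite -cats1 rise_cat rise_cons rise_nil addr0. Qed.

(** The vertices of the walk [w] started at [p] are the translates by [p] of the
    endpoints of its prefixes. *)
Lemma mem_trace (p v : int * int) (w : walk) :
  v \in p :: scanl +%R p (map vect w) <->
  exists a c, w = a ++ c /\ v = p + endpoint a.
Proof.
elim: w p v => [|s w IHw] p v.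
  rewrite /= inE; split=> [/eqP->|]; first by exists [::], [::]; rewrite addr0.
  by case=> -[|s a] [c [// _ ->]]; rewrite addr0.
rewrite inE [scanl _ _ _]/=; split=> [/predU1P[->|/IHw[a [c [-> ->]]]]|].
- by exists [::], (s :: w); rewrite addr0.
- by exists (s :: a), c; rewrite endpoint_cons addrA.
case=> -[|s' a] [c [/= def_w ->]]; first by rewrite addr0 eqxx.
case: def_w => <- def_w; apply/orP; right.
by apply/IHw; exists a, c; rewrite endpoint_cons addrA.
Qed.

Lemma mem_vertices (w : walk) (v : int * int) :
  v \in vertices w <-> exists a c, w = a ++ c /\ v = endpoint a.
Proof.
by rewrite mem_trace; split=> -[a [c [-> ->]]]; exists a, c; rewrite add0r.
Qed.

(** A walk is self-avoiding when no nonempty factor closes up. *)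
Lemma self_avoidingP (w : walk) :
  self_avoiding w <->
  forall a b c, w = a ++ b ++ c -> endpoint b = 0 -> b = [::].
Proof.
suff H p : uniq (p :: scanl +%R p (map vect w)) <->
    forall a b c, w = a ++ b ++ c -> endpoint b = 0 -> b = [::] by apply: H.
elim: w p => [|s w IHw] p; first by split=> // _ [|s a] [|s' b].
rewrite [map _ _]/= [scanl _ _ _]/= cons_uniq; split.
  case/andP=> p_notin /IHw uniq_w [|s' a] b c /=; last first.
    by case=> _; apply: uniq_w.
  case: b => // s' b [<- def_w] b0; case/negP: p_notin.
  apply/mem_trace; exists b, c; split=> //.
  by rewrite -addrA -endpoint_cons b0 addr0.
move=> H; apply/andP; split; last first.
  by apply/IHw => a b c def_w; apply: (H (s :: a) b c); rewrite def_w.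
apply/negP => /mem_trace[a [c [def_w]]].
rewrite -addrA -endpoint_cons -[X in X = _]addr0 => /addrI /esym a0.
by have := H [::] (s :: a) c; rewrite /= def_w => /(_ erefl a0).
Qed.

Lemma self_avoiding_infix (a b c : walk) :
  self_avoiding (a ++ b ++ c) -> self_avoiding b.
Proof.
move/self_avoidingP=> sa; apply/self_avoidingP => a' b' c' def_b.
by apply: (sa (a ++ a') b' (c' ++ c)); rewrite def_b -!catA.
Qed.

Lemma self_avoiding_catl (u v : walk) :
  self_avoiding (u ++ v) -> self_avoiding u.
Proof. exact: (@self_avoiding_infix [::]). Qed.

Lemma self_avoiding_catr (u v : walk) :
  self_avoiding (u ++ v) -> self_avoiding v.
Proof. by rewrite -{1}(cats0 v); apply: self_avoiding_infix. Qed.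

Lemma bridgeP (w : walk) :
  bridge w <->
  self_avoiding w /\
  forall a c, w = a ++ c -> c <> [::] -> 0 <= rise a < rise w.
Proof.
split=> -[sa_w H]; split=> //.
  move=> a c def_w c0; apply: H; first by apply/mem_vertices; exists a, c.
  apply/eqP; rewrite def_w endpoint_cat -[X in X = _]addr0 => /addrI/esym c_0.
  apply: c0; move/self_avoidingP: sa_w; apply; last exact: c_0.
  by rewrite def_w; congr (a ++ _); rewrite -[LHS]cats0.
move=> v /mem_vertices[a [c [def_w ->]]] /eqP ne_aw; apply: (H a c) => // c0.
by case: ne_aw; rewrite def_w c0 cats0.
Qed.

Lemma pseudo_bridgeP (w : walk) :
  pseudo_bridge w <->
  self_avoiding w /\ forall a c, w = a ++ c -> 0 <= rise a <= rise w.
Proof.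
split=> -[sa_w H]; split=> //.
  by move=> a c def_w; apply: H; apply/mem_vertices; exists a, c.
by move=> v /mem_vertices[a [c [def_w ->]]]; apply: H def_w.
Qed.

(** * Concatenation and factorization of bridges *)

Lemma bridge_nil : bridge [::].
Proof. by apply/bridgeP; split=> // -[|s a] [|s' b]. Qed.

Lemma cat_split (T : Type) (u v a c : seq T) : u ++ v = a ++ c ->
  (exists d, a = u ++ d /\ v = d ++ c) \/
  (exists d, [/\ u = a ++ d, c = d ++ v & d <> [::]]).
Proof.
elim: u a => [|x u IHu] [|y a] /=; first by left; exists [::].
- by left; exists (y :: a).
- by move=> <-; right; exists (x :: u).
case=> <- /IHu[[d [-> ->]]|[d [-> -> d0]]]; first by left; exists d.
by right; exists d.
Qed.

Lemma bridge_prefix_ge0 (a c : walk) : bridge (a ++ c) -> 0 <= rise a.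
Proof.
move=> /bridgeP[_ H]; case: c H => [|s c] H; last first.
  by have /andP[] := H a (s :: c) erefl ltac:(by []).
case: a H => [|s a]; first by rewrite rise_nil.
rewrite cats0 => H; have /andP[_] := H [::] (s :: a) erefl ltac:(by []).
by rewrite rise_nil => /ltW.
Qed.

Lemma bridge_suffix_gt0 (a c : walk) :
  bridge (a ++ c) -> c <> [::] -> 0 < rise c.
Proof.
move=> /bridgeP[_ H] /(H a c erefl) /andP[_].
by rewrite rise_cat ltrDl.
Qed.

Lemma bridge_cat (u v : walk) : bridge u -> bridge v -> bridge (u ++ v).
Proof.
move=> Bu Bv; have /bridgeP[sa_u Hu] := Bu; have /bridgeP[sa_v Hv] := Bv.
apply/bridgeP; split.
  apply/self_avoidingP => a b c.
  case/cat_split=> [[d [_ def_v]]|[d [def_u def_bc d0]]] b0.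
    exact: (iffLR (self_avoidingP v) sa_v d b c).
  case/cat_split: def_bc => [[e [def_d _]]|[e [def_b def_v _]]].
    apply: (iffLR (self_avoidingP u) sa_u a b e) => //.
    by rewrite def_u def_d.
  have : 0 <= rise e by apply: (@bridge_prefix_ge0 _ c); rewrite -def_v.
  have : 0 < rise d by apply: (@bridge_suffix_gt0 a) => //; rewrite -def_u.
  have : rise b = 0 by rewrite /rise b0.
  by rewrite def_b rise_cat; lia.
move=> a c /cat_split[[d [-> def_v]]|[d [def_u _ d0]]] c0.
  have := Hv d c def_v c0; have := @bridge_prefix_ge0 u [::].
  by rewrite cats0 !rise_cat => /(_ Bu); lia.
have := Hu a d def_u d0; have := @bridge_prefix_ge0 v [::].
by rewrite cats0 !rise_cat => /(_ Bv); lia.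
Qed.

(** An overlap of two bridges, suffix of one and prefix of the other, is a
    bridge. *)
Lemma bridge_middle (u x v : walk) :
  bridge (u ++ x) -> bridge (x ++ v) -> bridge x.
Proof.
move=> Bux Bxv; have [sa_ux H] := iffLR (bridgeP _) Bux.
apply/bridgeP; split; first exact: self_avoiding_catr sa_ux.
move=> a c def_x c0; apply/andP; split.
  by move: Bxv; rewrite def_x -catA; apply: bridge_prefix_ge0.
have := H (u ++ a) c; rewrite def_x -catA => /(_ erefl c0) /andP[_].
by rewrite !rise_cat; lia.
Qed.

(** No irreducible bridge is a proper prefix of another one when both are
    continued by bridges to the same walk. *)
Lemma irreducible_bridge_prefix (u v u' v' : walk) :
  irreducible_bridge u -> irreducible_bridge u' -> bridge v -> bridge v' ->
  u ++ v = u' ++ v' -> size u = size u'.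
Proof.
have no_split (a d b : walk) : d <> [::] ->
  irreducible_bridge a -> irreducible_bridge (a ++ d) ->
  bridge (d ++ b) -> False.
  move=> d0 [Ba a0 _] [Bad _ irr] Bdb; apply: irr; exists a, d.
  by split=> //; apply: bridge_middle Bad Bdb.
move=> Iu Iu' Bv Bv' /cat_split[[d [def_u' def_v]]|[d [def_u def_v' d0]]].
  have [d0|/eqP d0] := eqVneq d [::]; first by rewrite def_u' d0 cats0.
  by case: (@no_split u d v' d0 Iu); rewrite -?def_u' -?def_v.
by case: (@no_split u' d v d0 Iu'); rewrite -?def_u -?def_v'.
Qed.

(** The walks that are concatenations of words satisfying [P]. *)
Definition star (P : walk -> Prop) (w : walk) : Prop :=
  exists ws : seq walk, w = flatten ws /\ {in ws, forall u, P u}.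

Lemma star_bridge (P : walk -> Prop) (w : walk) :
  (forall u, P u -> irreducible_bridge u) -> star P w -> bridge w.
Proof.
move=> PI [ws [-> ]]; elim: ws => [|u ws IHws] Pws; first exact: bridge_nil.
apply: bridge_cat; first by case: (PI u (Pws u (mem_head _ _))).
by apply: IHws => v ws_v; apply: Pws; rewrite inE ws_v orbT.
Qed.

(** A concatenation of words of [P] is either empty or splits uniquely into a
    first factor in [P] and a shorter concatenation. *)
Lemma length_gf_star (P : walk -> Prop) :
  (forall w, P w -> irreducible_bridge w) ->
  length_gf (star P) * (1 - length_gf P) = 1.
Proof.
move=> PI; rewrite mulrBr mulr1; apply/eqP; rewrite subr_eq; apply/eqP.
have star_bridge := star_bridge PI.
rewrite mulrC -(@length_gf_cat P (star P)
    (fun w => exists u v, [/\ w = u ++ v, P u & star P v])) //; last first.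
  move=> u v u' v' Pu Sv Pu' Sv'.
  by apply: irreducible_bridge_prefix; auto.
rewrite -length_gf_nil -length_gf_or; last first.
  by move=> w -> [[|s u] [v [// _ /PI[]]]].
apply: eq_length_gf => w; split.
  case=> -[[-> _]|u ws [-> Pws]]; [by left | right].
  exists u, (flatten ws); split=> //; first exact: (Pws u (mem_head _ _)).
  by exists ws; split=> [//|x ws_x]; apply: Pws; rewrite inE ws_x orbT.
case=> [->|[u [v [-> Pu [ws [-> Pws]]]]]]; first by exists [::].
exists (u :: ws); split=> // x; rewrite inE => /predU1P[->//|]; apply: Pws.
Qed.

(** Existence of the factorization into irreducible bridges. *)
Lemma star_irreducible_bridge (A : pred step) (w : walk) :
  bridge w /\ all A w <-> star (fun u => irreducible_bridge u /\ all A u) w.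
Proof.
split=> [[]|[ws [-> ]]]; last first.
  elim: ws => [|u ws IHws] Pws; first by split=> //; apply: bridge_nil.
  have [[Bu _ _] Au] := Pws u (mem_head _ _).
  have [v ws_v|Bws Aws] := IHws; first by apply: Pws; rewrite inE ws_v orbT.
  by split; [apply: bridge_cat | rewrite /= all_cat Au].
have [n] := ubnP (size w); elim: n w => // n IHn w lt_wn Bw Aw.
have [->|/eqP w0] := eqVneq w [::]; first by exists [::].
have [[u [v [def_w Bu Bv u0 v0]]]|irr] := EM (exists u v : walk,
   [/\ w = u ++ v, bridge u, bridge v, u <> [::] & v <> [::]]); last first.
  exists [:: w]; rewrite /= cats0; split=> // u; rewrite inE => /eqP->.
  by split.
move: lt_wn Aw; rewrite def_w size_cat all_cat => lt_uvn /andP[Au Av].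
have lt_0u : (0 < size u)%N by case: (u) u0.
have lt_0v : (0 < size v)%N by case: (v) v0.
have [lt_un lt_vn] : (size u < n)%N /\ (size v < n)%N by lia.
have [[us [-> Pus]] [vs [-> Pvs]]] := (IHn u lt_un Bu Au, IHn v lt_vn Bv Av).
exists (us ++ vs); rewrite flatten_cat; split=> [//|x].
by rewrite mem_cat => /orP[/Pus|/Pvs].
Qed.

(** * Bridges and pseudo-bridges *)

(** The steps that increase the height. *)
Definition up_steps : {set step} := [set North; East].

(** A computable form of the equality test on steps. *)
Lemma eq_stepE (s s' : step) : (s == s') =
  match s, s' with
  | North, North | East, East | South, South | West, West => true
  | _, _ => false
  end.
Proof. by apply/eqP/idP; case: s; case: s'. Qed.

Lemma height_vect (s : step) :
  height (vect s) = if s \in up_steps then 1 else -1.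
Proof. by rewrite !inE !eq_stepE; case: s. Qed.

(** A nonempty bridge is a pseudo-bridge followed by an up step: steps change
    the height by one, so the last vertex exceeds all others by at least one
    exactly when it is reached by an up step from a vertex of maximal height. *)
Lemma bridge_rcons (u : walk) (s : step) :
  bridge (rcons u s) <-> pseudo_bridge u /\ s \in up_steps.
Proof.
split.
  move=> /bridgeP[]; rewrite -cats1 => /self_avoiding_catl sa_u H.
  have /andP[_] := H u [:: s] erefl ltac:(by []).
  rewrite cats1 rise_rcons height_vect; case: ifP => up_s lt_u; last by lia.
  split=> //; apply/pseudo_bridgeP; split=> // a c def_u.
  have := H a (rcons c s); rewrite def_u cats1 rcons_cat => /(_ erefl).
  rewrite -rcons_cat -def_u rise_rcons height_vect up_s.
  by move=> /(_ ltac:(by case: (c))); lia.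
case=> /pseudo_bridgeP[sa_u Hu] up_s.
have rise_us : rise (rcons u s) = rise u + 1.
  by rewrite rise_rcons height_vect up_s.
apply/bridgeP; split; last first.
  move=> a c; case/lastP: c => // c s'.
  rewrite -rcons_cat => /rcons_inj[def_u _] _.
  by have := Hu a c def_u; rewrite rise_us; lia.
apply/self_avoidingP => a b c; case/lastP: c => [|c s']; last first.
  rewrite -!rcons_cat => /rcons_inj[def_u _].
  exact: (iffLR (self_avoidingP u) sa_u a b c).
rewrite cats0; case/lastP: b => // b s'.
rewrite -rcons_cat => /rcons_inj[def_u <-] b0.
have /andP[_] := Hu a b def_u; have : rise (rcons b s) = 0 by rewrite /rise b0.
rewrite def_u rise_cat rise_rcons height_vect up_s; lia.
Qed.

(** Summing over all heights merely forgets the height. *)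
Lemma fps_sum_step_pseudo_bridge (A : {set step}) :
  fps_sum (fun k => length_gf (step_pseudo_bridge A k)) =
  length_gf (fun w => pseudo_bridge w /\ all (mem A) w).
Proof.
apply/fpsP => n; rewrite coefs_length_gf.
rewrite (coefs_fps_sum (m := n.+1)) //; last exact: coefs_step_pseudo_bridge.
under eq_bigr do rewrite coefs_length_gf.
rewrite exchange_big; apply: eq_bigr => w _ /=.
case: asboolP => [[Pw Aw] | nPw]; last first.
  rewrite big1 // => k _.
  by rewrite asboolF // => -[/andP[_ Aw] Pw _]; apply: nPw.
have rise_ge0 : 0 <= rise w.
  have /pseudo_bridgeP[_ /(_ w [::])] := Pw.
  by rewrite cats0 => /(_ erefl) /andP[].
have lt_n : (`|rise w| < n.+1)%N.
  by have := height_endpoint_le w; rewrite size_tuple -/(rise w); lia.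
have spb k : step_pseudo_bridge A k w <-> `|rise w|%N = k.
  rewrite /step_pseudo_bridge /step_walk subr0 -/(rise w) Aw.
  by case: (Pw) => -> _; split=> [[_ _]|]; [|split=> //]; lia.
rewrite (bigD1 (Ordinal lt_n)) //= asboolT; last exact/spb.
rewrite big1 ?addr0 // => k ne_k; rewrite asboolF // => /spb def_k.
by case/eqP: ne_k; apply: val_inj.
Qed.

(** The length series of the irreducible bridges with all steps in [A]. *)
Definition irreducible_gf (A : {pred step}) : fps int :=
  length_gf (fun w => irreducible_bridge w /\ all A w).

(** The first factor is the series of all [A]-bridges, which are empty or a
    pseudo-bridge followed by an up step; by factorization into irreducible
    bridges, the second one is its inverse. *)
Lemma bridge_gf_irreducible_gf (A : {set step}) :
  let B := fps_sum (fun k => length_gf (step_pseudo_bridge A k)) in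
  (1 + #|A :&: up_steps|%:R * fpsX * B) * (1 - irreducible_gf (mem A)) = 1.
Proof.
move=> B; rewrite -[RHS](length_gf_star (P := fun w =>
  irreducible_bridge w /\ all (mem A) w)) => [|w []//].
congr (_ * _); rewrite mulrC /B fps_sum_step_pseudo_bridge -length_gf_letter.
pose Q w := exists2 s, s \in A :&: up_steps & w = [:: s].
rewrite -(@length_gf_cat _ _ (fun w => exists u v,
  [/\ w = u ++ v, pseudo_bridge u /\ all (mem A) u & Q v])) //; last first.
  move=> u v u' v' _ [s _ ->] _ [s' _ ->].
  by rewrite !cats1 => /(congr1 size); rewrite !size_rcons => -[].
rewrite -length_gf_nil -length_gf_or; last first.
  move=> w -> [u [v [def_w _ [s _ def_v]]]].
  by rewrite def_v in def_w; case: u def_w.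
apply: eq_length_gf => w; rewrite -star_irreducible_bridge; split.
  case=> [->|[u [v [-> [Pu Au] [s /setIP[As up_s] ->]]]]].
    by split=> //; apply: bridge_nil.
  rewrite cats1 all_rcons Au andbT; split=> //.
  exact/bridge_rcons.
case=> Bw Aw; case/lastP: w => [|u s] in Bw Aw *; [by left | right].
have /bridge_rcons[Pu up_s] := Bw; move: Aw; rewrite all_rcons => /andP[As Au].
exists u, [:: s]; rewrite cats1; split=> //; exists s => //; exact/setIP.
Qed.

(** * Reflection in the diagonal *)

(** The action on steps of the reflection exchanging the two coordinates. *)
Definition transpose (s : step) : step :=
  match s with
  | North => East | East => North | South => West | West => South
  end.

Lemma transposeK : involutive transpose. Proof. by case. Qed.

Lemma endpoint_transpose (w : walk) :
  endpoint (map transpose w) = ((endpoint w).2, (endpoint w).1).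
Proof.
elim: w => // s w IHw.
by rewrite /= !endpoint_cons IHw; case: s.
Qed.

Lemma rise_transpose (w : walk) : rise (map transpose w) = rise w.
Proof. by rewrite /rise endpoint_transpose /height /= addrC. Qed.

Lemma bridge_transpose (w : walk) : bridge (map transpose w) <-> bridge w.
Proof.
have imp u : bridge u -> bridge (map transpose u).
  move=> /bridgeP[/self_avoidingP sa Hu]; apply/bridgeP; split.
    apply/self_avoidingP => a b c /(congr1 (map transpose)).
    rewrite (mapK transposeK) !map_cat => /sa sab b0.
    have := sab; rewrite endpoint_transpose b0 => /(_ erefl).
    by case: (b).
  move=> a c /(congr1 (map transpose)); rewrite (mapK transposeK) map_cat.
  move=> /Hu Ha c0; rewrite rise_transpose -(rise_transpose a).
  by apply: Ha; case: (c) c0.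
by split=> /imp //; rewrite (mapK transposeK).
Qed.

Lemma irreducible_bridge_transpose (w : walk) :
  irreducible_bridge (map transpose w) <-> irreducible_bridge w.
Proof.
have imp u : irreducible_bridge u -> irreducible_bridge (map transpose u).
  case=> Bu u0 irr; split; first exact/bridge_transpose.
    by case: (u) u0.
  case=> a [c [/(congr1 (map transpose))]]; rewrite (mapK transposeK) map_cat.
  move=> def_u Ba Bc a0 c0; apply: irr.
  exists (map transpose a), (map transpose c).
  split; rewrite ?bridge_transpose //; [by case: (a) a0|by case: (c) c0].
by split=> /imp //; rewrite (mapK transposeK).
Qed.

Lemma irreducible_gf_transpose (A : {pred step}) :
  irreducible_gf [pred s | transpose s \in A] = irreducible_gf A.
Proof.
rewrite /irreducible_gf -[RHS](length_gf_map _ transposeK).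
apply: eq_length_gf => w; rewrite irreducible_bridge_transpose.
by rewrite all_map; split=> -[].
Qed.

Lemma eq_irreducible_gf (A B : {pred step}) : A =i B ->
  irreducible_gf A = irreducible_gf B.
Proof.
by move=> AB; apply: eq_length_gf => w; rewrite (eq_all AB).
Qed.

(** * Partially directed irreducible bridges *)

Lemma bridge_up (w : walk) : all (mem up_steps) w -> bridge w.
Proof.
elim/last_ind: w => [|w s IHw]; first by move=> _; apply: bridge_nil.
rewrite all_rcons => /andP[up_s /IHw Bw]; apply/bridge_rcons; split=> //.
apply/pseudo_bridgeP; have /bridgeP[sa_w Hw] := Bw; split=> // a c def_w.
case: c def_w => [|s' c] def_w; last first.
  by have := Hw a (s' :: c) def_w ltac:(by []); lia.
have : 0 <= rise w by apply: (@bridge_prefix_ge0 w [::]); rewrite cats0.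
by move: def_w; rewrite cats0 => ->; rewrite lexx => ->.
Qed.

(** A walk with up steps only is a bridge, hence reducible as soon as it has two
    steps. *)
Lemma irreducible_bridge_up (w : walk) :
  irreducible_bridge w /\ all (mem up_steps) w <->
  exists2 s, s \in up_steps & w = [:: s].
Proof.
split=> [[[Bw w0 irr] up_w]|[s up_s ->]]; last first.
  have up_w : all (mem up_steps) [:: s] by rewrite /= andbT.
  split=> //; split=> //; first exact: bridge_up.
  by case=> -[|x [|y u]] [[|z v] [//]].
case: w => [//|s w] in Bw w0 irr up_w *; exists s; first by case/andP: up_w.
case: w => [//|s' w] in Bw w0 irr up_w *; case: irr; exists [:: s], (s' :: w).
have /andP[up_s up_w'] := up_w.
by split=> //; apply: bridge_up => //; rewrite /= andbT.
Qed.

(** A self-avoiding walk on a line never turns back. *)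
Lemma self_avoiding_line (s s' : step) (w : walk) : vect s + vect s' = 0 ->
  self_avoiding (s :: w) -> all (pred2 s s') w -> all (pred1 s) w.
Proof.
move=> ss'0; elim: w => //= x w IHw sa_w /andP[/orP[/eqP def_x|/eqP def_x] Aw].
  rewrite def_x eqxx; apply: IHw => //.
  by apply: (@self_avoiding_catr [:: s]); rewrite /= -{2}def_x.
have /self_avoidingP /(_ [::] [:: s; x] w erefl) := sa_w.
by rewrite !endpoint_cons addr0 def_x ss'0 => /(_ erefl).
Qed.

(** A nonempty bridge that is confined to a line has only up steps: its first
    step goes up and it never turns back. *)
Lemma bridge_line (s s' : step) (w : walk) :
  s \in up_steps -> vect s + vect s' = 0 -> bridge w -> w <> [::] ->
  all (pred2 s s') w -> s' \notin w.
Proof.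
move=> up_s ss'0 Bw w0; case: w => // x w in Bw w0 *.
have ss' : s' != s.
  apply/eqP => e; move: up_s ss'0.
  by rewrite e !inE !eq_stepE; case: (s).
have sa_w : self_avoiding (x :: w) by case: Bw.
case/andP=> /orP[/eqP def_x|/eqP def_x] Aw.
  rewrite def_x in sa_w *; have := self_avoiding_line ss'0 sa_w Aw.
  rewrite inE negb_or ss' => /allP Hs; apply/negP => /Hs /=; exact/negP.
have := @bridge_prefix_ge0 [:: x] w Bw; rewrite rise_cons rise_nil.
by move: up_s ss'0; rewrite def_x !inE !eq_stepE; case: (s); case: (s').
Qed.

(** Inclusion-exclusion over the avoided steps: N and E are never both avoided,
    and the pairs NS and EW cancel the triples NSW and ESW. *)
Lemma partially_directed_bridge (w : walk) :
  bridge w -> w <> [::] ->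
  (`[< partially_directed w >]%:R : int) =
    (North \notin w)%:R + (East \notin w)%:R + (South \notin w)%:R
    + (West \notin w)%:R - ((North \notin w) && (West \notin w))%:R
    - ((East \notin w) && (South \notin w))%:R
    - ((South \notin w) && (West \notin w))%:R.
Proof.
move=> Bw w0; have sa_w : self_avoiding w by case: Bw.
have -> : `[< partially_directed w >] = [|| North \notin w, East \notin w,
    South \notin w | West \notin w].
  rewrite asboolb /partially_directed sa_w /=; apply/existsP/or4P.
    by case=> -[] ?; [apply: Or41 | apply: Or42 | apply: Or43 | apply: Or44].
  by case=> ?; [exists North | exists East | exists South | exists West].
have NE : (North \in w) || (East \in w).
  (* The last step of a nonempty bridge is an up step. *)
  case/lastP: w w0 Bw {sa_w} => // u s _ /bridge_rcons[_].
  by rewrite !mem_rcons !inE => /orP[] /eqP->; rewrite eqxx ?orbT.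
have all2 s s' : (forall x, x \in w -> x = s \/ x = s') -> all (pred2 s s') w.
  by move=> H; apply/allP => x /H /= [] ->; rewrite eqxx ?orbT.
have NS : North \notin w -> South \notin w -> West \notin w.
  move=> nN nS; apply: (@bridge_line East) => //.
    by rewrite !inE !eq_stepE.
  by apply: all2 => -[] xw; auto; [rewrite xw in nN | rewrite xw in nS].
have EW : East \notin w -> West \notin w -> South \notin w.
  move=> nE nW; apply: (@bridge_line North) => //.
    by rewrite !inE !eq_stepE.
  by apply: all2 => -[] xw; auto; [rewrite xw in nE | rewrite xw in nW].
move: NE NS EW; case: (North \in w); case: (East \in w) => //= _;
  case: (South \in w); case: (West \in w) => //= NS EW; try by [].
(* What is left is to exclude walks confined to the line NS or to EW that use
   both of its directions. *)
- by have := EW isT isT.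
- by have := NS isT isT.
Qed.

Lemma all_predC1 (T : eqType) (x : T) (s : seq T) :
  all (predC1 x) s = (x \notin s).
Proof. by rewrite (all_predC (pred1 x)) has_pred1. Qed.

Lemma partially_directed_gf :
  length_gf (fun w => irreducible_bridge w /\ partially_directed w) =
    irreducible_gf (predC1 North) + irreducible_gf (predC1 East)
    + irreducible_gf (predC1 South) + irreducible_gf (predC1 West)
    - irreducible_gf (predI (predC1 North) (predC1 West))
    - irreducible_gf (predI (predC1 East) (predC1 South))
    - irreducible_gf (predI (predC1 South) (predC1 West)).
Proof.
apply/fpsP => n; rewrite !(coefsB, coefsD) !coefs_length_gf.
rewrite -!(big_split, sumrB) /=; apply: eq_bigr => w _.
rewrite !asbool_and !all_predI !all_predC1 !asboolb.
case: (asboolP (irreducible_bridge w)) => //= -[Bw w0 _].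
by rewrite -partially_directed_bridge // asboolb.
Qed.

Lemma irreducible_gf_up :
  irreducible_gf (predI (predC1 South) (predC1 West)) = 2 * fpsX.
Proof.
have <- : #|up_steps|%:R = 2 :> fps int by rewrite cards2 eq_stepE.
rewrite -length_gf_letter; apply: eq_length_gf => w.
rewrite -irreducible_bridge_up (@eq_all _ _ (mem up_steps)) // => s.
by rewrite /= !inE !eq_stepE; case: s.
Qed.

Lemma irreducible_gf_quotient (A : {set step}) (c : nat) :
  #|A :&: up_steps| = c ->
  let B := fps_sum (fun k => length_gf (step_pseudo_bridge A k)) in
  irreducible_gf (mem A) = (c%:R * fpsX * B) / (1 + c%:R * fpsX * B).
Proof.
move=> <- B; set x := _ * _ * B.
have xI : (1 + x) * (1 - irreducible_gf (mem A)) = 1.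
  exact: bridge_gf_irreducible_gf.
have Ux : 1 + x \is a GRing.unit by apply/unitrPr; eexists; apply: xI.
apply: (canRL (mulrK Ux)); rewrite mulrC.
move: xI; rewrite mulrBr mulr1 => /eqP; rewrite subr_eq => /eqP.
by move=> /addrI.
Qed.

Theorem proposition22 :
  let t : fps int := fpsX in
  let B0 := fps_sum (fun k =>
    length_gf (step_pseudo_bridge [set East; South] k)) in
  let B1 := fps_sum (fun k =>
    length_gf (step_pseudo_bridge [set East; South; West] k)) in
  let B2 := fps_sum (fun k =>
    length_gf (step_pseudo_bridge [set North; East; South] k)) in
  length_gf pd_irreducible_bridge =
    1 / (1 + 2 * t - (2 * t * B1) / (1 + t * B1)
         - (4 * t * B2) / (1 + 2 * t * B2) + (2 * t * B0) / (1 + t * B0)).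
Proof.
move=> t B0 B1 B2.
pose I := length_gf (fun w => irreducible_bridge w /\ partially_directed w).
have -> : length_gf pd_irreducible_bridge =
    length_gf (star (fun w => irreducible_bridge w /\ partially_directed w)).
  apply: eq_length_gf => w; split=> [[_]//|Sw]; split=> //.
  by apply: star_bridge Sw => u [].
have := @length_gf_star (fun w => irreducible_bridge w /\ partially_directed w).
rewrite -/I => /(_ (fun w => @proj1 _ _)) WI.
have -> : 1 + 2 * t - (2 * t * B1) / (1 + t * B1)
    - (4 * t * B2) / (1 + 2 * t * B2) + (2 * t * B0) / (1 + t * B0) = 1 - I.
  have card1 (A : {set step}) : East \in A -> North \notin A ->
      #|A :&: up_steps| = 1.
    move=> EA NA; rewrite (_ : _ :&: _ = [set East]) ?cards1 //.
    apply/setP => s; rewrite !inE !eq_stepE.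
    by case: s; rewrite ?andbT ?andbF ?EA ?(negPf NA).
  have I0 : irreducible_gf (predI (predC1 North) (predC1 West))
      = t * B0 / (1 + t * B0).
    rewrite -[t in RHS]mul1r -(irreducible_gf_quotient (c := 1)); last first.
      by rewrite card1 // !inE !eq_stepE.
    by apply: eq_irreducible_gf => s; rewrite !inE !eq_stepE; case: s.
  have I1 : irreducible_gf (predC1 North) = t * B1 / (1 + t * B1).
    rewrite -[t in RHS]mul1r -(irreducible_gf_quotient (c := 1)); last first.
      by rewrite card1 // !inE !eq_stepE.
    by apply: eq_irreducible_gf => s; rewrite !inE !eq_stepE; case: s.
  have I2 : irreducible_gf (predC1 West) = 2 * t * B2 / (1 + 2 * t * B2).
    rewrite -(irreducible_gf_quotient (c := 2)); last first.
      rewrite (_ : _ :&: _ = up_steps) ?cards2 ?eq_stepE //.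
      by apply/setP => s; rewrite !inE !eq_stepE; case: s.
    by apply: eq_irreducible_gf => s; rewrite !inE !eq_stepE; case: s.
  have tr (A A' : {pred step}) : (forall s, (s \in A') = (transpose s \in A)) ->
      irreducible_gf A' = irreducible_gf A.
    move=> AA'; rewrite -[RHS]irreducible_gf_transpose.
    exact: eq_irreducible_gf.
  rewrite /I partially_directed_gf irreducible_gf_up -/t.
  rewrite (tr (predC1 North) (predC1 East)); last first.
    by move=> s; rewrite !inE !eq_stepE; case: s.
  rewrite (tr (predC1 West) (predC1 South)); last first.
    by move=> s; rewrite !inE !eq_stepE; case: s.
  rewrite (tr (predI (predC1 North) (predC1 West))
              (predI (predC1 East) (predC1 South))); last first.
    by move=> s; rewrite !inE !eq_stepE; case: s.
  rewrite I0 I1 I2; ring.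
rewrite div1r; apply/esym; have U : 1 - I \is a GRing.unit.
  by apply/unitrPr; eexists; rewrite mulrC; exact: WI.
by apply: (mulIr U); rewrite mulVr.
Qed.
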